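(* Let $G$ be a finite group and $V$ a finite $G$-module. Let $g\in G$ be an element of prime order not dividing $|V|$. Then the number of irreducible complex characters of the semidirect product $GV$ whose restriction to $A=\langle g\rangle$ is not an integer multiple of the regular character of $\langle g\rangle$ is at most $$|C_G(g)|\; n(C_G(g),C_V(g)),$$ where $n(C_G(g),C_V(g))$ denotes the number of orbits of $C_G(g)$ on $C_V(g)$.
   Context: A finite $G$-module is a finite abelian group on which $G$ acts by automorphisms (the action need not be faithful). $GV$ denotes the semidirect product of $V$ by $G$ with respect to this action, with $G$ and $V$ regarded as subgroups. $C_G(g)$ is the centralizer of $g$ in $G$ and $C_V(g)$ is the set of fixed points of $g$ in $V$. *)

(* Defs.v *)
From mathcomp Require Import all_boot all_order all_algebra all_fingroup.
From mathcomp Require Import all_solvable all_field all_character.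

Set Implicit Arguments.
Unset Strict Implicit.
Unset Printing Implicit Defensive.

Import Order.TTheory GRing.Theory Num.Theory GroupScope.

(* A finite G-module is an abelian V : {group rT} together with a group       *)
(* action to : groupAction G V.  The semidirect product GV is                 *)
(* [set: sdprod_by to]; G and V embed in it through sdpair2 and sdpair1.      *)

Definition norbits (aT : finGroupType) (D : {group aT}) (T : finType)
    (to : action D T) (H : {set aT}) (X : {set T}) : nat :=
  #|orbit to H @: X|.

(* 'Z[S] is the (decidable) set of integral combinations of S; see            *)
(* cfReg_intmultP.                                                            *)
Definition cfReg_intmult (gT : finGroupType) (A : {group gT}) (phi : 'CF(A)) :
    bool :=
  phi \in 'Z[[:: cfReg A]].

Lemma cfReg_intmultP (gT : finGroupType) (A : {group gT}) (phi : 'CF(A)) :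
  reflect (exists z : int, phi = (cfReg A *~ z)%R) (cfReg_intmult phi).
Proof.
apply: (iffP idP) => [|[z ->]]; last first.
  by rewrite /cfReg_intmult rpredMz // mem_zchar ?mem_head.
case/zchar_expansion=> // a Za ->; have /intrP[z az] := Za (cfReg A).
by exists z; rewrite big_seq1 az scaler_int.
Qed.

(* Main.v *)
(* Put A = <[g]>, W = C_V(g) and H = A x W.  If the restriction of chi to A is *)
(* not a multiple of the regular character, then for some irreducible          *)
(* character lambda of W the multiplicities of the mu x lambda in chi_H are    *)
(* not all equal as mu runs over Irr(A), so the discrete inequality            *)
(* |A| sum n^2 - (sum n)^2 >= |A| - 1 bounds the sum of |chi|^2 over H :\: W   *)
(* below by (|A| - 1)|W|.  By the second orthogonality relation, summing over  *)
(* all chi gives the sum over H :\: W of the orders of the centralizers of aw  *)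
(* in GV, which are |W| |C_C(w)| with C = C_G(g), as a and w have coprime      *)
(* orders; and the orders |C_C(w)| add up to |C| n(C, W).                      *)

Require Import Defs.
From mathcomp Require Import all_boot all_order all_algebra all_fingroup.
From mathcomp Require Import all_solvable all_field all_character.

Set Implicit Arguments.
Unset Strict Implicit.
Unset Printing Implicit Defensive.

Import Order.TTheory GRing.Theory Num.Theory GroupScope.

(** Double counting of the sum of [|chi x| ^+ 2] over all irreducible [chi] of GV and all [x] in
    [H :\: W]. By rows, each character to be counted contributes at least [(|A| - 1)|W|]
    ([leq_sum_norm_dprodD], resting on [sqrn_sum_leq_neq]). By columns, second orthogonality gives
    centralizer orders, which [card_cent1_mul] shows to be independent of the nontrivial [a] in A;
    so the same factor [(|A| - 1)|W|] comes out and cancels ([card_irr_sdprod_not_reg]). The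
    remaining sum of stabilizer orders is an orbit count ([sum_card_fix_norbits]). *)

Lemma sqrn_sum_leq_neq (I : finType) (f : I -> nat) (i j : I) :
  f i != f j ->
  (#|I|.-1 + (\sum_k f k) ^ 2 <= #|I| * \sum_k f k ^ 2)%N.
Proof.
(* Every pair with exactly one member in the fibre [S] has distinct values. Both [S] and its
   complement are nonempty, so their sizes have product at least [#|I| - 1]. *)
move=> neq_fij; pose S := [set k | f k == f i].
have Si : i \in S by rewrite inE.
have S'j : j \in ~: S by rewrite !inE eq_sym.
have cardS : (#|I|.-1 <= #|S| * #|~: S|)%N.
  have S_gt0 : (0 < #|S|)%N by apply/card_gt0P; exists i.
  have S'_gt0 : (0 < #|~: S|)%N by apply/card_gt0P; exists j.
  rewrite -(cardsC S); case: #|S| S_gt0 => // m _.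
  case: #|~: S| S'_gt0 => // n _.
  by rewrite addSn addnS mulSn mulnS addnA addSn ltnS (addnC n) leq_addr.
have sum_neq : (2 * (#|S| * #|~: S|)
    <= \sum_k \sum_l ((f k == f i) != (f l == f i)))%N.
  rewrite (bigID [in S]) /= mul2n -addnn leq_add //.
    rewrite -sum_nat_const leq_sum // => k; rewrite inE => ->.
    rewrite -sum1_card [leqRHS](bigID [in ~: S]) /= -[leqLHS]addn0 leq_add //.
    by apply: leq_sum => l; rewrite !inE => /negPf->.
  rewrite mulnC -[#|~: S|](eq_card (A := [predC S])); last first.
    by move=> k; rewrite !inE.
  rewrite -sum_nat_const leq_sum // => k; rewrite !inE => /negPf->.
  rewrite -sum1_card [leqRHS](bigID [in S]) /= -[leqLHS]addn0 leq_add //.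
  by apply: leq_sum => l; rewrite !inE => ->.
(* After doubling, the difference of the two sides of Cauchy-Schwarz is the sum of [(f k - f l) ^ 2]
   over ordered pairs, and each separated pair gives at least 1. *)
rewrite -(leq_pmul2l (n1 := _ + _) (isT : 0 < 2)) mulnDr.
have -> : (2 * (#|I| * \sum_k f k ^ 2) = \sum_k \sum_l (f k ^ 2 + f l ^ 2))%N.
  under [RHS]eq_bigr do rewrite big_split sum_nat_const /=.
  by rewrite big_split /= sum_nat_const -big_distrr /= mul2n addnn.
have -> : (2 * (\sum_k f k) ^ 2 = \sum_k \sum_l (2 * (f k * f l)))%N.
  rewrite expnS expn1 big_distrlr big_distrr /=.
  by apply: eq_bigr => k _; rewrite big_distrr.
apply: leq_trans (leq_add (leq_trans _ sum_neq) (leqnn _)) _.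
  by rewrite leq_mul2l.
rewrite -big_split leq_sum //= => k _; rewrite -big_split leq_sum //= => l _.
have [le_kl eq_kl] := nat_Cauchy (f k) (f l).
case: eqVneq => [_ //|neq_kl]; rewrite add1n ltn_neqAle le_kl eq_kl andbT.
by apply: contraNneq neq_kl => ->.
Qed.

Lemma sum_sqr_cfdot_irr (gT : finGroupType) (B : {group gT}) (psi : 'CF(B)) :
  psi \is a character ->
  (\sum_(x in B) `|psi x| ^+ 2
     = (#|B| * \sum_k Num.truncn '[psi, 'chi_k] ^ 2)%:R)%R.
Proof.
move=> Npsi; have nzB := neq0CG B.
transitivity (#|B|%:R * '[psi])%R.
  rewrite cfdotE mulVKf //; apply: eq_bigr => x _; exact: normCK.
rewrite natrM natr_sum cfdot_sum_irr; congr (_ * _)%R; apply: eq_bigr => k _.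
have Nk := Cnat_cfdot_char_irr k Npsi.
by rewrite natrX truncnK // conj_natr // expr2.
Qed.

Section DirectProduct.

Variables (gT : finGroupType) (A K H : {group gT}) (AxK : A \x K = H).
Variable phi : 'CF(H).
Hypotheses (cAA : abelian A) (Nphi : phi \is a character).

Let n (i : Iirr A) (j : Iirr K) : nat :=
  Num.truncn '[phi, 'chi_(dprod_Iirr AxK (i, j))]%R.

Let phiE : phi = (\sum_i \sum_j (n i j)%:R *: cfDprod AxK 'chi_i 'chi_j)%R.
Proof.
rewrite {1}[phi]cfun_sum_cfdot (reindex (dprod_Iirr AxK)) /=; last first.
  exists (inv_dprod_Iirr AxK) => k _.
    exact: dprod_IirrK.
  exact: inv_dprod_IirrK.
rewrite pair_bigA; apply: eq_bigr => -[i j] _ /=.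
by rewrite dprod_IirrE truncnK ?Cnat_cfdot_char_irr // dprod_IirrE.
Qed.

Let Res_leftE :
  ('Res[A] phi = \sum_i (\sum_j (n i j)%:R * 'chi_j 1%g) *: 'chi_i)%R.
Proof.
rewrite {1}phiE linear_sum; apply: eq_bigr => i _.
rewrite linear_sum scaler_suml; apply: eq_bigr => j _.
by rewrite linearZ /= cfDprod_Resl scalerA.
Qed.

Let Res_rightE : ('Res[K] phi = \sum_j (\sum_i n i j)%:R *: 'chi_j)%R.
Proof.
rewrite {1}phiE exchange_big linear_sum; apply: eq_bigr => j _.
rewrite linear_sum natr_sum scaler_suml; apply: eq_bigr => i _.
by rewrite linearZ /= cfDprod_Resr (lin_char1 (char_abelianP A cAA i)) scale1r.
Qed.

(** By Parseval on H and on K, the sum over [H :\: K] is [|K|] times the sum over [j] of the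
    Cauchy-Schwarz defect of the column [n^~ j]. Every defect is nonnegative, and a nonconstant
    column has defect at least [|A| - 1]. *)
Lemma leq_sum_norm_dprodD :
  ~~ cfReg_intmult ('Res[A] phi)%R ->
  ((#|A|.-1 * #|K|)%:R <= \sum_(x in H :\: K) `|phi x| ^+ 2)%R.
Proof.
move=> nreg; have sKH : K \subset H by have /mulG_sub[] := dprodW AxK.
have sumHD : (\sum_(x in H :\: K) `|phi x| ^+ 2 =
   \sum_(x in H) `|phi x| ^+ 2 - \sum_(x in K) `|('Res[K] phi) x| ^+ 2)%R.
  rewrite [in RHS](big_setID K) (setIidPr sKH) /= addrC.
  suffices -> : (\sum_(x in K) `|('Res[K] phi) x| ^+ 2
                 = \sum_(x in K) `|phi x| ^+ 2)%R by rewrite addrK.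
  by apply: eq_bigr => x Kx; rewrite cfResE.
have cfdot_Res j : Num.truncn '['Res[K] phi, 'chi_j]%R = (\sum_i n i j)%N.
  rewrite Res_rightE cfdot_suml (bigD1 j) //= cfdotZl cfnorm_irr mulr1.
  rewrite [X in (_ + X)%R]big1 ?addr0 ?natrK // => k /negPf nkj.
  by rewrite cfdotZl cfdot_irr nkj mulr0.
rewrite sumHD !sum_sqr_cfdot_irr ?cfRes_char // lerBrDr -natrD ler_nat.
rewrite (reindex (dprod_Iirr AxK)) /=; last first.
  exists (inv_dprod_Iirr AxK) => k _.
    exact: dprod_IirrK.
  exact: inv_dprod_IirrK.
under [X in (_ + #|K| * X)%N]eq_bigr do rewrite cfdot_Res.
rewrite -(dprod_card AxK) (mulnC #|A|) -mulnA mulnC -mulnDr leq_mul2l.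
apply/orP; right.
rewrite (eq_bigr (fun p => n p.1 p.2 ^ 2)%N); last by case.
rewrite -(pair_bigA _ (fun i j => n i j ^ 2)%N) exchange_big big_distrr /=.
(* If all columns were constant, every irreducible character of A, being linear, would occur in the
   restriction with the same multiplicity [m], making it [m] times the regular character. *)
have: [exists i, [exists i', [exists j, n i j != n i' j]]].
  apply: contraR nreg => /existsPn eq_n; apply/cfReg_intmultP.
  have{}eq_n i j : n i j = n 0%R j.
    have /existsPn/(_ 0%R)/existsPn/(_ j)/negPn/eqP := eq_n i; exact.
  pose m := (\sum_j n 0%R j * Num.truncn ('chi[K]_j 1%g)%R)%N.
  exists (Posz m); rewrite Res_leftE cfReg_sum -pmulrn -sumrMnl.
  apply: eq_bigr => i _; rewrite (lin_char1 (char_abelianP A cAA i)) scale1r.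
  rewrite -scaler_nat /m natr_sum; congr (_ *: _)%R; apply: eq_bigr => j _.
  by rewrite eq_n natrM (truncnK (Cnat_irr1 j)).
case/existsP=> i /existsP[i' /existsP[j neq_n]].
have leq_col k : ((\sum_i n i k) ^ 2 <= #|A| * \sum_i n i k ^ 2)%N.
  rewrite -(card_Iirr_abelian cAA).
  have [[k1 /existsP[k2 neq_k]]|/existsPn eq_k] :=
      altP (@existsP _ (fun k1 => [exists k2, n k1 k != n k2 k])).
    exact: leq_trans (leq_addl _ _) (sqrn_sum_leq_neq (f := n^~ k) neq_k).
  have{}eq_k l : n l k = n 0%R k.
    by have /existsPn/(_ 0%R)/negPn/eqP := eq_k l.
  under eq_bigr do rewrite eq_k.
  under [X in (_ <= _ * X)%N]eq_bigr do rewrite eq_k.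
  by rewrite !sum_nat_const expnMn !mulnA.
rewrite (bigD1 j) //= [leqRHS](bigD1 j) //= addnA leq_add //; last first.
  exact: leq_sum.
by rewrite -(card_Iirr_abelian cAA) (sqrn_sum_leq_neq (f := n^~ j) neq_n).
Qed.

End DirectProduct.

(** The Cauchy-Frobenius formula, with the pairs (element, fixed point) counted by points. *)
Lemma sum_card_fix_norbits (aT : finGroupType) (D : {group aT}) (T : finType)
    (to : action D T) (H : {group aT}) (S : {set T}) :
  [acts H, on S | to] ->
  (\sum_(x in S) #|[set a in H | to x a == x]| = #|H| * norbits to H S)%N.
Proof.
move=> actsHS; rewrite mulnC -(Frobenius_Cauchy actsHS).
under eq_bigr do rewrite cardsE -sum1_card.
under [RHS]eq_bigr do rewrite -sum1_card.
rewrite (exchange_big_dep [in H]) => [|x a _ /andP[] //] /=.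
apply: eq_bigr => a Ha; apply: eq_bigl => x.
by rewrite !inE sub1set inE [a \in _]unfold_in Ha.
Qed.

(** Since [a] and [v] commute and have coprime orders, centralizing [a * v] means centralizing both.
    Inside ['C_L[g]], the semidirect product of ['C_V[g]] by ['C_G[g]], the factor ['C_V[g]] already
    centralizes [v] because V is abelian; the modular law does the rest. *)
Lemma card_cent1_mul (gT : finGroupType) (L V G : {group gT}) (g a v : gT) :
    V ><| G = L -> abelian V -> g \in G -> <[a]> = <[g]> ->
    coprime #[g] #|V| -> v \in 'C_V[g] ->
  (#|'C_L[a * v]| = #|'C_V[g]| * #|'C_('C_G[g])[v]|)%N.
Proof.
move=> defL cVV Gg eq_ag co_gV /setIP[Vv cgv].
have [_ _ nVG _] := sdprodP defL.
have cav : 'C[a] = 'C[g] by rewrite -!cent_cycle eq_ag.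
have commav : commute a v by apply/cent1P; rewrite cent1C cav.
have co_av : coprime #[a] #[v].
  by rewrite /order eq_ag (coprime_dvdr (order_dvdG Vv)).
have C_av : 'C[a * v] = 'C[g] :&: 'C[v].
  by rewrite -cent_cycle cycleM // centM !cent_cycle cav.
have defC : 'C_V[g] ><| 'C_G[g] = 'C_L[g].
  rewrite -!cent_cycle; apply: subcent_sdprod => //.
  rewrite cycle_subG inE (subsetP nVG) //=.
  exact: (subsetP (normG G)).
have [_ mulVG _ tiVG] := sdprodP defC.
have sWv : 'C_V[g] \subset 'C[v].
  by apply: subset_trans (subsetIl _ _) _; rewrite sub_cent1 (subsetP cVV).
rewrite C_av setIA -mulVG -group_modl // TI_cardMg //.
by apply/trivgP; rewrite -tiVG setIS // subsetIl.
Qed.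

Lemma eq_cycle_prime (gT : finGroupType) (g a : gT) :
  prime #[g] -> a \in <[g]>^# -> <[a]> = <[g]>.
Proof.
move=> pr_g /setD1P[nt_a g_a]; apply/eqP; rewrite eqEcard cycle_subG g_a.
have nt_oa : #[a] != 1%N by rewrite order_eq1.
have := order_dvdG g_a; rewrite -!orderE => /(prime_nt_dvdP pr_g nt_oa)->.
by rewrite leqnn.
Qed.

Lemma big_dprodD1 (R : Type) (idx : R) (op : Monoid.com_law idx)
    (gT : finGroupType) (A K H : {group gT}) (F : gT -> R) :
  A \x K = H ->
  \big[op/idx]_(x in H :\: K) F x
    = \big[op/idx]_(a in A^#) \big[op/idx]_(k in K) F (a * k).
Proof.
move=> AxK; have [_ defH _ tiAK] := dprodP AxK.
pose h (u : gT * gT) := u.1 * u.2.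
have inj_h : {in setX A^# K &, injective h}.
  case=> a k [b l]; rewrite !inE /h /= -!andbA.
  move=> /and3P[_ Aa Kk] /and3P[_ Ab Kl] eq_h.
  have Hak : a * k \in H by rewrite -defH mem_mulg.
  have [y [z [_ _ _ uniq_yz]]] := mem_dprod AxK Hak.
  have [-> ->] := uniq_yz a k Aa Kk erefl.
  by have [-> ->] := uniq_yz b l Ab Kl eq_h.
have -> : H :\: K = h @: setX A^# K.
  apply/setP=> x; apply/setDP/imsetP=> [[]|[[a k]]].
    rewrite -defH => /mulsgP[a k Aa Kk ->] nKak; exists (a, k) => //.
    rewrite !inE Aa Kk !andbT /=; apply: contraNneq nKak => ->.
    by rewrite mul1g.
  rewrite !inE /= -andbA => /and3P[nta Aa Kk] -> /=.
  rewrite -defH mem_mulg // groupMr //; split=> //.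
  apply: contra nta => Ka; by rewrite -in_set1 -[[set 1]]tiAK inE Aa.
rewrite big_imset //= pair_big /=; apply: eq_bigl => u.
by rewrite inE.
Qed.

Lemma card_irr_sdprod_not_reg (gT : finGroupType) (L V G : {group gT})
    (g : gT) :
    V ><| G = L -> abelian V -> g \in G -> prime #[g] -> ~~ (#[g] %| #|V|)%N ->
  (#|[set i : Iirr L | ~~ cfReg_intmult ('Res[<[g]>] 'chi_i)%R]|
     <= \sum_(v in 'C_V[g]) #|'C_('C_G[g])[v]|)%N.
Proof.
move=> defL cVV Gg pr_g ndvd_gV; set Bad := [set i | _].
have [_ mulVG _ _] := sdprodP defL.
have [sVL sGL] := mulG_sub mulVG.
have co_gV : coprime #[g] #|V| by rewrite prime_coprime.
pose A := <[g]>; pose W := 'C_V[g]; pose H := A <*> W.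
have tiAW : A :&: W = 1.
  by apply/coprime_TIg/(coprime_dvdr _ co_gV)/cardSg/subsetIl.
have AxW : A \x W = H.
  by rewrite dprodEY // cent_cycle subsetIr.
have sHL : H \subset L.
  by rewrite join_subG cycle_subG (subsetP sGL) // subIset ?sVL.
have sAH : A \subset H by apply: joing_subl.
have cardA1 : #|A^#| = #|A|.-1 by rewrite (cardsD1 1 A) group1.
have pos : (0 < #|A|.-1 * #|W|)%N.
  by rewrite muln_gt0 cardG_gt0 andbT -subn1 subn_gt0 prime_gt1.
rewrite -(leq_pmul2l pos) -(ler_nat algC).
have -> : ((#|A|.-1 * #|W| * \sum_(v in W) #|'C_('C_G[g])[v]|)%:R
    = \sum_(x in H :\: W) \sum_i `|'chi[L]_i x| ^+ 2 :> algC)%R.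
  rewrite (big_dprodD1 _ _ AxW) -mulnA -cardA1 -sum_nat_const natr_sum.
  apply: eq_bigr => a Aa; rewrite big_distrr natr_sum.
  apply: eq_bigr => v Wv /=.
  have eq_ag := eq_cycle_prime pr_g Aa.
  rewrite -(card_cent1_mul defL cVV Gg eq_ag co_gV Wv).
  have Lav : a * v \in L.
    have /setD1P[_ A_a] := Aa.
    by apply: (subsetP sHL); rewrite -[H](dprodW AxW) mem_mulg.
  have := second_orthogonality_relation (a * v) Lav.
  rewrite class_refl mulr1n => <-; apply: eq_bigr => i _; exact/esym/normCK.
(* The characters outside [Bad] contribute nonnegative terms and are dropped. *)
rewrite exchange_big /= (bigID [in Bad]) /= natrM mulr_natr -sumr_const.
rewrite -[leLHS]addr0 lerD ?sumr_ge0 //; last first.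
  by move=> i _; rewrite sumr_ge0 // => x _; rewrite exprn_ge0.
apply: ler_sum => i; rewrite inE => bad_i.
have := @leq_sum_norm_dprodD _ _ _ _ AxW ('Res[H] 'chi_i)%R (cycle_abelian g).
rewrite cfResRes // => /(_ (cfRes_char _ (irr_char i)) bad_i) /le_trans-> //.
rewrite le_eqVlt; apply/orP; left; apply/eqP; apply: eq_bigr => x /setDP[Hx _].
by rewrite cfResE.
Qed.

Theorem theoremB (aT rT : finGroupType) (G : {group aT}) (V : {group rT})
    (to : groupAction G V) (g : aT) :
  abelian V ->
  g \in G ->
  prime #[g] ->
  ~~ (#[g] %| #|V|)%N ->
  (#|[set i : Iirr [set: sdprod_by to] |
       ~~ cfReg_intmult ('Res[<[sdpair2 to g]>] 'chi_i)%R]|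
     <= #|'C_G[g]| * norbits to 'C_G[g] 'C_(V | to)[g])%N.
Proof.
move=> cVV Gg pr_g ndvd_gV.
have inj1 := injm_sdpair1 to; have inj2 := injm_sdpair2 to.
have ord_g : #[sdpair2 to g] = #[g] by apply: order_injm.
(* In GV the action becomes conjugation, so commuting with the image of [v] is the same as fixing
   [v]. *)
have fixE v a : v \in V -> a \in G ->
    (sdpair2 to a \in 'C[sdpair1 to v]) = (to v a == v).
  move=> Vv Ga; rewrite -(inj_in_eq (injmP inj1)) ?gact_stable //.
  rewrite /= sdpair_act // cent1C; apply/cent1P/eqP => [cva|].
    by rewrite conjgE cva mulKg.
  by move=> fix_v; rewrite /commute conjgC fix_v.
have defCV : 'C_(sdpair1 to @* V)[sdpair2 to g] = sdpair1 to @: 'C_(V | to)[g].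
  apply/setP=> x; rewrite gacent1E //.
  apply/setIP/imsetP=> [[/morphimP[v Vv _ ->]] | [v]].
    rewrite cent1C fixE // => fix_v; exists v => //.
    by rewrite !inE Vv sub1set inE.
  case/setIP=> Vv /setIP[_ /afix1P fix_v] ->; rewrite mem_morphim //.
  by rewrite cent1C fixE // fix_v.
have sWV : 'C_(V | to)[g] \subset V by exact: subsetIl.
apply: leq_trans (card_irr_sdprod_not_reg (sdprod_sdpair to) _ _ _ _) _.
- exact: morphim_abelian.
- exact: mem_morphim.
- by rewrite ord_g.
- by rewrite ord_g card_injm.
rewrite defCV big_imset /=; last first.
  by apply: sub_in2 (injmP inj1) => v /(subsetP sWV).
rewrite -sum_card_fix_norbits; last first.
  by apply: acts_subnorm_subgacent; rewrite ?sub1set ?astabs_range.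
apply: leq_sum => v /(subsetP sWV) Vv.
(* The centralizer of the image of [v] lies in the image of the stabilizer of [v], and an image is
   no larger than its source. *)
rewrite -injm_subcent1 //.
apply: leq_trans (leq_imset_card (sdpair2 to) _); apply: subset_leq_card.
apply/subsetP=> _ /setIP[/morphimP[a Ga Ca ->] cva].
by apply: imset_f; rewrite inE Ca -fixE.
Qed.
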